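(* Let $\beta>0$ and let $x^*$ be a strong $\beta$-Lagrangian stationary point, with Lagrangian multiplier $y^*\in\mathbb{R}^m$, of the problem $\min_{x\in\mathbb{R}^n} f(x)$ subject to $h(x)=0$, $x\in\mathbb{S}$. Suppose that for every $T\in\mathcal{J}_s(x^* )$: (a) $\mathrm{rank}(\nabla_Th(x^* ))=m$; and (b) $d^\top(\nabla^2_{xx}L(x^*,y^* ))_{T,T}\,d>0$ for every nonzero $d\in\mathbb{R}^s$ with $\nabla_Th(x^* )d=0$. Then the matrix $\nabla_{(x,y)}F(x^*,y^*;T)$ is nonsingular for each index set $T\in\mathbb{T}(x^*,y^*;\beta)$.
   Context: Let $n,m,s$ be positive integers with $0<s<n$; $f:\mathbb{R}^n\to\mathbb{R}$ and $h=(h_1,\dots,h_m)^\top:\mathbb{R}^n\to\mathbb{R}^m$ are twice continuously differentiable. $\|x\|_0$ is the number of nonzero components of $x$, $\mathbb{S}=\{x\in\mathbb{R}^n:\|x\|_0\le s\}$, $\mathrm{supp}(x)=\{i:x_i\neq0\}$, $\mathcal{J}_s=\{J\subseteq\{1,\dots,n\}:|J|=s\}$, $\mathcal{J}_s(x)=\{J\in\mathcal{J}_s:\mathrm{supp}(x)\subseteq J\}$; $T^c=\{1,\dots,n\}\setminus T$. $x_T$ is the subvector indexed by $T$; $A_{I,J}$ is the submatrix with rows $I$ and columns $J$; $A_{T,\cdot}$ is the submatrix of rows $T$. $\nabla h(x)\in\mathbb{R}^{m\times n}$ is the Jacobian of $h$ and $\nabla_Th(x)$ its submatrix of columns indexed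 by $T$. Lagrangian: $L(x,y)=f(x)-\langle y,h(x)\rangle$, with gradient $\nabla_xL$ and Hessian $\nabla^2_{xx}L(x,y)=\nabla^2f(x)-\sum_{i=1}^my_i\nabla^2h_i(x)$ in $x$. $\Pi_{\mathbb{S}}(z)=\arg\min_{w\in\mathbb{S}}\|z-w\|^2$ (in general a set). For $\beta>0$, $x^*$ is a strong $\beta$-Lagrangian stationary point with Lagrangian multiplier $y^*$ if $x^*=\Pi_{\mathbb{S}}(x^*-\beta\nabla_xL(x^*,y^* ))$ (meaning the projection set is the singleton $\{x^*\}$) and $h(x^* )=0$. For $x\in\mathbb{S}$, $y\in\mathbb{R}^m$, put $u=x-\beta\nabla_xL(x,y)$ and $\mathbb{T}(x,y;\beta)=\{T\in\mathcal{J}_s: |u_i|\ge|u_j|\ \forall i\in T,\ \forall j\in T^c\}$. For $T\in\mathcal{J}_s$ let $F(x,y;T)=\big[(\nabla_xL(x,y))_T;\ x_{T^c};\ -h(x)\big]$; its Jacobian in $(x,y)$, with $T$ held fixed, is $$\nabla_{(x,y)}F(x,y;T)=\begin{bmatrix}(\nabla^2_{xx}L(x,y))_{T,\cdot}&-(\nabla_Th(x))^\top\\ I_{T^c,\cdot}&0\\ -\nabla h(x)&0\end{bmatrix}\in\mathbb{R}^{(n+m)\times(n+m)},$$ where $I$ is the $n\times n$ identity matrix. *)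

(* Defs.v *)
From HB Require Import structures.
From mathcomp Require Import all_boot all_order all_algebra.
From mathcomp Require Import all_classical all_reals all_analysis.

Set Implicit Arguments.
Unset Strict Implicit.
Unset Printing Implicit Defensive.

Import Order.TTheory GRing.Theory Num.Theory.
Import numFieldNormedType.Exports.

Local Open Scope ring_scope.

(* Points of R^n are row vectors, as the library operator ['J] requires.  The
   library's Jacobian acts on row vectors ([v *m 'J f x]), hence the transpose
   in [Jac], whose (i, j) entry is the j-th partial derivative of the i-th
   component. *)
Section Calculus.
Variable R : realType.

Definition Jac (n m : nat) (g : 'rV[R]_n -> 'rV[R]_m) (x : 'rV[R]_n) :
  'M[R]_(m, n) := ('J g x)^T.

Definition gradient (n : nat) (f : 'rV[R]_n -> R) (x : 'rV[R]_n) : 'rV[R]_n :=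
  \row_i 'D_(delta_mx 0 i) f x.

Definition hessian (n : nat) (f : 'rV[R]_n -> R) (x : 'rV[R]_n) : 'M[R]_n :=
  Jac (gradient f) x.

Definition twice_continuously_differentiable (n : nat) (f : 'rV[R]_n -> R) :=
  [/\ forall x, differentiable f x,
      forall x, differentiable (gradient f) x &
      continuous (hessian f)].

End Calculus.

Section Submatrix.
Variables (R : Type) (m n : nat).

Definition mx_rows (T : {set 'I_m}) (A : 'M[R]_(m, n)) : 'M[R]_(#|T|, n) :=
  rowsub (fun i : 'I_#|T| => enum_val i) A.

Definition mx_cols (T : {set 'I_n}) (A : 'M[R]_(m, n)) : 'M[R]_(m, #|T|) :=
  colsub (fun j : 'I_#|T| => enum_val j) A.

Definition mx_block (I : {set 'I_m}) (J : {set 'I_n}) (A : 'M[R]_(m, n)) :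
  'M[R]_(#|I|, #|J|) :=
  mxsub (fun i : 'I_#|I| => enum_val i) (fun j : 'I_#|J| => enum_val j) A.

End Submatrix.

Section Sparsity.
Variables (R : realType) (n : nat).

Definition supp (x : 'rV[R]_n) : {set 'I_n} := finset (fun i => x 0 i != 0).

Definition norm0 (x : 'rV[R]_n) : nat := #|supp x|.

Definition sparse (s : nat) : set 'rV[R]_n := [set x | (norm0 x <= s)%N]%classic.

Definition index_sets (s : nat) : {set {set 'I_n}} :=
  finset (fun J : {set 'I_n} => #|J| == s).

Definition index_sets_at (s : nat) (x : 'rV[R]_n) : {set {set 'I_n}} :=
  finset (fun J : {set 'I_n} => (J \in index_sets s) && (supp x \subset J)).

(* The library norm on row vectors is the sup norm; the projection is taken
   with respect to the Euclidean one. *)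
Definition sqnorm2 (x : 'rV[R]_n) : R := \sum_i x 0 i ^+ 2.

Definition proj_sparse (s : nat) (z : 'rV[R]_n) : set 'rV[R]_n :=
  [set w | sparse s w /\
     forall w', sparse s w' -> sqnorm2 (z - w) <= sqnorm2 (z - w')]%classic.

End Sparsity.

Section Problem.
Variables (R : realType) (n m : nat).
Variables (f : 'rV[R]_n -> R) (h : 'rV[R]_n -> 'rV[R]_m).
Implicit Types (x : 'rV[R]_n) (y : 'rV[R]_m) (T : {set 'I_n}) (beta : R).

Definition Lagrangian x y : R := f x - \sum_(i < m) y 0 i * h x 0 i.

Definition grad_L x y : 'rV[R]_n := gradient (Lagrangian^~ y) x.

Definition hess_L x y : 'M[R]_n := hessian (Lagrangian^~ y) x.

Definition strong_stationary (s : nat) beta x y : Prop :=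
  proj_sparse s (x - beta *: grad_L x y) = [set x]%classic /\ h x = 0.

Definition TT (s : nat) beta x y : {set {set 'I_n}} :=
  let u := x - beta *: grad_L x y in
  finset (fun T : {set 'I_n} => (T \in index_sets n s) &&
    [forall i in T, forall j in ~: T, `|u 0 j| <= `|u 0 i|]).

Lemma card_blocks T : (#|T| + (#|~: T| + m) = n + m)%N.
Proof. by rewrite addnA cardsC card_ord. Qed.

(* The cast only identifies the width [#|T| + (#|~: T| + m)] of the
   concatenated row with [n + m], so that the Jacobian below has a square
   matrix type. *)
Definition stationarity_map T x y : 'rV[R]_(n + m) :=
  castmx (erefl, card_blocks T)
    (row_mx (mx_cols T (grad_L x y)) (row_mx (mx_cols (~: T) x) (- h x))).

Definition Jac_stationarity_map T x y : 'M[R]_(n + m) :=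
  Jac (fun z : 'rV[R]_(n + m) => stationarity_map T (lsubmx z) (rsubmx z))
      (row_mx x y).

End Problem.

Section DerivativeFacts.
Variable R : realType.

Lemma differentiable_rV (k n : nat) (g : 'rV[R]_k -> 'rV[R]_n) (x : 'rV[R]_k) :
  (forall j, differentiable (fun z => g z 0 j) x) -> differentiable g x.
Proof.
move=> gd.
rewrite (_ : g = \sum_(j < n) (fun z => g z 0 j *: (delta_mx 0 j : 'rV[R]_n))).
  by apply: differentiable_sum => j; exact: differentiableZl.
by apply/funext => z; rewrite fct_sumE [LHS]row_sum_delta.
Qed.

Lemma JacE (k n : nat) (g : 'rV[R]_k -> 'rV[R]_n) (x : 'rV[R]_k) i j :
  differentiable g x ->
  Jac g x i j = 'D_(delta_mx 0 j) (fun z => g z 0 i) x.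
Proof.
move=> gd; rewrite !mxE -deriveE// derive_mx ?mxE//.
exact: diff_derivable.
Qed.

Lemma derive_lsubmx (n m : nat) (g : 'rV[R]_n -> R) (z v : 'rV[R]_(n + m)) :
  'D_v (fun z => g (lsubmx z)) z = 'D_(lsubmx v) g (lsubmx z).
Proof.
rewrite /derive /=.
suff -> : (fun t => t^-1 *: (g (lsubmx (t *: v + z)) - g (lsubmx z))) =
  (fun t => t^-1 *: (g (t *: lsubmx v + lsubmx z) - g (lsubmx z))) by [].
by apply/funext => t; rewrite linearP.
Qed.

End DerivativeFacts.

Section ProblemFacts.
Variables (R : realType) (n m : nat).
Variables (f : 'rV[R]_n -> R) (h : 'rV[R]_n -> 'rV[R]_m).
Hypothesis f2 : twice_continuously_differentiable f.
Hypothesis h2 : forall i, twice_continuously_differentiable (fun x => h x 0 i).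
Implicit Types (x : 'rV[R]_n) (y : 'rV[R]_m) (T : {set 'I_n}).

Let df x : differentiable f x. Proof. by case: f2. Qed.
Let dh i x : differentiable (fun x => h x 0 i) x. Proof. by case: (h2 i). Qed.
Let dgf x j : differentiable (fun x => gradient f x 0 j) x.
Proof.
apply: (@differentiable_comp _ _ _ _ (gradient f) (fun v : 'rV_n => v 0 j)).
  by case: f2.
exact: differentiable_coord.
Qed.
Let dgh i x j : differentiable (fun x => gradient (fun x => h x 0 i) x 0 j) x.
Proof.
apply: (@differentiable_comp _ _ _ _ (gradient (fun x => h x 0 i))
  (fun v : 'rV_n => v 0 j)).
  by case: (h2 i).
exact: differentiable_coord.
Qed.
Let Dd (k : nat) (g : 'rV[R]_k -> R) (p v : 'rV[R]_k) :
  differentiable g p -> derivable g p v.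
Proof. exact: diff_derivable. Qed.

Lemma grad_LE x y :
  grad_L f h x y =
  gradient f x - \sum_(i < m) y 0 i *: gradient (fun x => h x 0 i) x.
Proof.
apply/rowP => j; rewrite !mxE summxE.
have -> : Lagrangian f h ^~ y =
    f - \sum_(i < m) (y 0 i \*: (fun x => h x 0 i)).
  by apply/funext => z; rewrite /Lagrangian !fctE fct_sumE.
rewrite deriveB; [|exact: Dd|]; last first.
  by apply: derivable_sum => i; apply: derivableZ; exact: Dd.
rewrite derive_sum; last by move=> i; apply: derivableZ; exact: Dd.
congr (_ - _); apply: eq_bigr => i _; rewrite deriveZ ?mxE//.
exact: Dd.
Qed.

Let diff_gradL x y : differentiable (grad_L f h ^~ y) x.
Proof.
rewrite (_ : grad_L f h ^~ y = gradient f -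
    \sum_(i < m) (y 0 i \*: gradient (fun x => h x 0 i))).
  apply: differentiableB; first by case: f2.
  apply: differentiable_sum => i; apply: differentiableZ.
  by case: (h2 i).
by apply/funext => z; rewrite grad_LE !fctE fct_sumE.
Qed.

Lemma hess_LE x y :
  hess_L f h x y =
  hessian f x - \sum_(i < m) y 0 i *: hessian (fun x => h x 0 i) x.
Proof.
apply/matrixP => i j; rewrite JacE; last exact: diff_gradL.
rewrite [RHS]mxE [X in _ = _ + X]mxE summxE [hessian f x i j]JacE; last first.
  by case: f2.
have -> : (fun z => gradient (Lagrangian f h ^~ y) z 0 i) =
    (fun z => gradient f z 0 i) -
    \sum_(k < m) (y 0 k \*: (fun z => gradient (fun x => h x 0 k) z 0 i)).
  apply/funext => z; rewrite -/(grad_L f h z y) grad_LE !fctE fct_sumE.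
  rewrite [LHS]mxE [X in _ + X = _]mxE summxE; congr (_ - _).
  by apply: eq_bigr => k _; rewrite mxE.
rewrite deriveB; [|exact: Dd|]; last first.
  by apply: derivable_sum => k; apply: derivableZ; exact: Dd.
rewrite derive_sum; last by move=> k; apply: derivableZ; exact: Dd.
congr (_ - _); apply: eq_bigr => k _.
rewrite deriveZ; last exact: Dd.
by rewrite mxE JacE//; case: (h2 k).
Qed.

Let dlsub (g : 'rV[R]_n -> R) (p : 'rV[R]_(n + m)) :
  (forall x, differentiable g x) -> differentiable (fun z => g (lsubmx z)) p.
Proof.
move=> gd; apply: (@differentiable_comp _ _ _ _ lsubmx g) => //.
exact: differentiable_lsubmx.
Qed.

Let drsub i (p : 'rV[R]_(n + m)) : differentiable (fun z => rsubmx z 0 i) p.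
Proof.
apply: (@differentiable_comp _ _ _ _ rsubmx (fun v : 'rV_m => v 0 i)).
  exact: differentiable_rsubmx.
exact: differentiable_coord.
Qed.

Let gradL_split k :
  (fun z : 'rV[R]_(n + m) => grad_L f h (lsubmx z) (rsubmx z) 0 k) =
  (fun z => gradient f (lsubmx z) 0 k) -
  \sum_(i < m) ((fun z => rsubmx z 0 i) *
                (fun z => gradient (fun x => h x 0 i) (lsubmx z) 0 k)).
Proof.
apply/funext => z; rewrite grad_LE !fctE fct_sumE.
rewrite [LHS]mxE [X in _ + X = _]mxE summxE; congr (_ - _).
by apply: eq_bigr => i _; rewrite mxE.
Qed.

Let diff_gradL_split k (p : 'rV[R]_(n + m)) :
  differentiable (fun z => grad_L f h (lsubmx z) (rsubmx z) 0 k) p.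
Proof.
rewrite gradL_split; apply: differentiableB.
  exact: (@dlsub (fun x => gradient f x 0 k)).
apply: differentiable_sum => i; apply: differentiableM => //.
exact: (@dlsub (fun x => gradient (fun x => h x 0 i) x 0 k)).
Qed.

Let derive_coord k (p v : 'rV[R]_k) i : 'D_v (fun z : 'rV_k => z 0 i) p = v 0 i.
Proof.
have := @derive_mx _ _ _ _ (id : 'rV[R]_k -> 'rV[R]_k) p v (@derivable_id _ _ p v).
by rewrite derive_id => /rowP/(_ i); rewrite mxE.
Qed.

Let derive_rsub i (p v : 'rV[R]_(n + m)) :
  'D_v (fun z => rsubmx z 0 i) p = rsubmx v 0 i.
Proof.
rewrite [RHS]mxE -(derive_coord p); congr ('D_v _ p).
by apply/funext => z; rewrite mxE.
Qed.

Let derive_gradL x y (v : 'rV[R]_(n + m)) k :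
  'D_v (fun z => grad_L f h (lsubmx z) (rsubmx z) 0 k) (row_mx x y) =
  'D_(lsubmx v) (fun z => grad_L f h z y 0 k) x -
  \sum_(i < m) rsubmx v 0 i * gradient (fun x => h x 0 i) x 0 k.
Proof.
rewrite gradL_split.
have dg i := @dlsub (fun x => gradient (fun x => h x 0 i) x 0 k) (row_mx x y)
  (fun x => dgh i x k).
have -> : (fun z => grad_L f h z y 0 k) = (fun z => gradient f z 0 k) -
    \sum_(i < m) (y 0 i \*: (fun z => gradient (fun x => h x 0 i) z 0 k)).
  apply/funext => z; rewrite grad_LE !fctE fct_sumE.
  rewrite [LHS]mxE [X in _ + X = _]mxE summxE; congr (_ - _).
  by apply: eq_bigr => i _; rewrite mxE.
rewrite deriveB; [|apply: Dd|]; last first.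
- by apply: derivable_sum => i; apply: derivableM; apply: Dd.
- exact: (@dlsub (fun x => gradient f x 0 k)).
rewrite deriveB; [|exact: Dd|]; last first.
  by apply: derivable_sum => i; apply: derivableZ; exact: Dd.
rewrite (derive_lsubmx (fun z => gradient f z 0 k)) row_mxKl -addrA; congr (_ + _).
rewrite -opprD; congr (- _).
rewrite derive_sum; last by move=> i; apply: derivableM; apply: Dd.
rewrite derive_sum; last by move=> i; apply: derivableZ; exact: Dd.
rewrite -big_split/=; apply: eq_bigr => i _.
rewrite deriveM; [|exact: Dd|exact: Dd].
rewrite deriveZ; last exact: Dd.
rewrite (derive_lsubmx (fun z => gradient (fun x => h x 0 i) z 0 k)).
by rewrite derive_rsub row_mxKl row_mxKr mulrC [X in _ + X]mulrC.
Qed.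

Let stat_gradE T x y a :
  stationarity_map f h T x y 0 (cast_ord (card_blocks m T) (lshift _ a)) =
  grad_L f h x y 0 (enum_val a).
Proof.
by rewrite castmxE cast_ordK row_mxEl mxE;
congr (grad_L _ _ _ _ _ _); exact: val_inj.
Qed.

Let stat_compE T x y b :
  stationarity_map f h T x y 0
    (cast_ord (card_blocks m T) (rshift _ (lshift _ b))) = x 0 (enum_val b).
Proof.
by rewrite castmxE cast_ordK row_mxEr row_mxEl mxE;
congr (x _ _); exact: val_inj.
Qed.

Let stat_consE T x y i :
  stationarity_map f h T x y 0
    (cast_ord (card_blocks m T) (rshift _ (rshift _ i))) = - h x 0 i.
Proof.
by rewrite castmxE cast_ordK !row_mxEr mxE;
congr (- h x _ _); exact: val_inj.
Qed.

Let diff_stat T (p : 'rV[R]_(n + m)) :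
  differentiable (fun z => stationarity_map f h T (lsubmx z) (rsubmx z)) p.
Proof.
apply: differentiable_rV => j; rewrite -(cast_ordKV (card_blocks m T) j).
case: (split_ordP (cast_ord (esym (card_blocks m T)) j)) => [a ->|j' ->].
  by under eq_fun do rewrite stat_gradE; exact: diff_gradL_split.
case: (split_ordP j') => [b ->|i ->].
  under eq_fun do rewrite stat_compE.
  apply: (@dlsub (fun x => x 0 (enum_val b))) => x.
  exact: differentiable_coord.
under eq_fun do rewrite stat_consE.
by apply: differentiableN; exact: (@dlsub (fun x => h x 0 i)).
Qed.

Lemma Jac_stationarity_mapE T x y :
  Jac_stationarity_map f h T x y =
  castmx (card_blocks m T, erefl)
    (col_mx (row_mx (mx_rows T (hess_L f h x y)) (- (mx_cols T (Jac h x))^T))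
    (col_mx (row_mx (mx_rows (~: T) 1%:M) 0)
            (row_mx (- Jac h x) 0))).
Proof.
have dhx p : differentiable h p by apply: differentiable_rV => i; exact: dh.
apply/matrixP => j k; rewrite castmxE cast_ord_id JacE; last exact: diff_stat.
rewrite -{1}(cast_ordKV (card_blocks m T) j).
set v : 'rV_(n + m) := delta_mx 0 k.
have vl k' : k = lshift m k' -> lsubmx v = delta_mx 0 k'.
  by move=> kE; rewrite /v kE; apply/rowP => l; rewrite !mxE !eqxx/= (inj_eq (@lshift_inj _ _)).
have vl0 i : k = rshift n i -> lsubmx v = 0.
  by move=> kE; rewrite /v kE; apply/rowP => l; rewrite !mxE eq_lrshift.
have vr i : k = rshift n i -> rsubmx v = delta_mx 0 i.
  by move=> kE; rewrite /v kE; apply/rowP => l; rewrite !mxE !eqxx/= (inj_eq (@rshift_inj _ _)).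
have vr0 k' : k = lshift m k' -> rsubmx v = 0.
  by move=> kE; rewrite /v kE; apply/rowP => l; rewrite !mxE eq_rlshift.
case: (split_ordP (cast_ord (esym (card_blocks m T)) j)) => [a ->|j' ->].
  under eq_fun do rewrite stat_gradE.
  rewrite derive_gradL col_mxEu.
  case: (split_ordP k) => [k' kE|i kE]; rewrite [in RHS]kE ?row_mxEl ?row_mxEr.
    rewrite (vl _ kE) (vr0 _ kE) big1 ?subr0 => [|i _]; last by rewrite mxE mul0r.
    rewrite -(@JacE _ _ _ (grad_L f h ^~ y)); last exact: diff_gradL.
    by rewrite [RHS]mxE.
  rewrite (vl0 _ kE) (vr _ kE) derive0 sub0r (bigD1 i)//= big1 ?addr0.
    rewrite [delta_mx 0 i 0 i]mxE !eqxx mul1r [RHS]mxE; congr (- _).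
    by rewrite [LHS]mxE [RHS]mxE [RHS]mxE JacE.
  by move=> l /negPf li; rewrite mxE li mul0r.
case: (split_ordP j') => [b ->|i ->].
  under eq_fun do rewrite stat_compE.
  rewrite (derive_lsubmx (fun x => x 0 (enum_val b))) derive_coord.
  rewrite col_mxEd col_mxEu.
  case: (split_ordP k) => [k' kE|i kE]; rewrite [in RHS]kE ?row_mxEl ?row_mxEr.
    by rewrite (vl _ kE) !mxE eq_sym.
  by rewrite (vl0 _ kE) !mxE.
under eq_fun do rewrite stat_consE.
rewrite deriveN; last by apply: Dd; exact: (@dlsub (fun x => h x 0 i)).
rewrite (derive_lsubmx (fun x => h x 0 i)) row_mxKl !col_mxEd.
case: (split_ordP k) => [k' kE|i' kE]; rewrite [in RHS]kE ?row_mxEl ?row_mxEr.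
  by rewrite (vl _ kE) [RHS]mxE JacE.
by rewrite (vl0 _ kE) derive0 oppr0 mxE.
Qed.

End ProblemFacts.

(* Main.v *)
(* The projection onto S being the singleton {xs} forces supp(xs) into T:
   otherwise some i in supp(xs) outside T and some j in T outside supp(xs)
   satisfy |u_i| <= |u_j|, and moving the i-th nonzero entry of xs to position
   j, with value u_j, yields another nearest sparse point.  Hence (a) and (b)
   apply to T, and the matrix is a KKT matrix in the variables d_T, once
   d_(T^c) = 0. *)
Require Import Defs.
From mathcomp Require Import all_boot all_order all_algebra.
From mathcomp Require Import all_classical all_reals all_analysis.
Import Order.TTheory GRing.Theory Num.Theory.
Import numFieldNormedType.Exports.
Local Open Scope ring_scope.

Set Implicit Arguments.
Unset Strict Implicit.
Unset Printing Implicit Defensive.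

Lemma proj_sparse_unique_supp (R : realType) (n s : nat) (u x : 'rV[R]_n)
    (T : {set 'I_n}) :
  proj_sparse s u = [set x]%classic -> #|T| = s ->
  (forall i j, i \in T -> j \notin T -> `|u 0 j| <= `|u 0 i|) ->
  supp x \subset T.
Proof.
move=> ux cT uT; apply/fintype.subsetP => i ix; apply: contraT => iT.
have [xs xmin] : proj_sparse s u x by rewrite ux.
(* [T] cannot lie inside [supp x]: since [#|supp x| <= s = #|T|], the two would coincide,
   contradicting the choice of [i]. *)
have [j jT jx] : exists2 j, j \in T & j \notin supp x.
  apply/subsetPn; apply: contra iT => Tx.
  suff /eqP -> : T == supp x by [].
  by rewrite eqEcard Tx cT.
have ij : i != j by apply: contra jx => /eqP <-.
have xj0 : x 0 j = 0 by apply/eqP; move: jx; rewrite inE negbK.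
pose w : 'rV[R]_n :=
  \row_k (if k == i then 0 else if k == j then u 0 j else x 0 k).
(* Position [i] leaves the support and at most [j] enters it. *)
have ws : sparse s w.
  apply: (@leq_trans #|j |: (supp x :\ i)|).
    apply/subset_leq_card/fintype.subsetP => k; rewrite !inE mxE.
    by have [|_] := eqVneq k i; have [|_] := eqVneq k j => //=; rewrite eqxx.
  rewrite cardsU1 (leq_trans _ xs)// /norm0 (cardsD1 i (supp x)) ix leq_add2r.
  by case: (_ \notin _).
(* The two distances differ only at [i] and [j], where [w] contributes [u_i^2 + 0] and [x]
   contributes [(u_i - x_i)^2 + u_j^2]; so [u_i^2 <= u_j^2] suffices. *)
have wx : sqnorm2 (u - w) <= sqnorm2 (u - x).
  rewrite /sqnorm2 (bigD1 i)//= (bigD1 j) 1?eq_sym//=.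
  rewrite [leRHS](bigD1 i)//= [X in _ <= _ + X](bigD1 j) 1?eq_sym//=.
  rewrite !addrA lerD//; last first.
    rewrite le_eqVlt; apply/orP; left; apply/eqP/eq_bigr => k /andP[ki kj].
    by rewrite !mxE (negPf ki) (negPf kj).
  rewrite !mxE !eqxx eq_sym (negPf ij) xj0 !subr0 subrr expr0n addr0.
  have uij : u 0 i ^+ 2 <= u 0 j ^+ 2.
    rewrite -(real_normK (num_real (u 0 i))) -(real_normK (num_real (u 0 j))).
    by rewrite lerXn2r ?nnegrE ?normr_ge0// uT.
  by rewrite (le_trans uij)// lerDr sqr_ge0.
have : proj_sparse s u w.
  by split=> // w' w's; rewrite (le_trans wx)// xmin.
rewrite ux => /rowP/(_ i); rewrite mxE eqxx => xi.
by move: ix; rewrite inE -xi eqxx.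
Qed.

Lemma TT_index_sets_at (R : realType) (n m s : nat) (f : 'rV[R]_n -> R)
    (h : 'rV[R]_n -> 'rV[R]_m) (beta : R) x y T :
  strong_stationary f h s beta x y -> T \in TT f h s beta x y ->
  T \in index_sets_at s x.
Proof.
move=> [ux _]; rewrite !inE => /andP[cT /forallP uT]; rewrite cT/=.
apply: (proj_sparse_unique_supp ux (eqP cT)) => i j iT jT.
move/implyP/(_ iT)/forallP/(_ j)/implyP: (uT i); apply.
by rewrite inE.
Qed.

Lemma unitmx_mulmx_inj (F : fieldType) (n : nat) (A : 'M[F]_n) :
  (forall v : 'cV_n, A *m v = 0 -> v = 0) -> A \in unitmx.
Proof.
(* [row_free] concerns the left kernel, hence the passage to the transpose. *)
move=> Ainj; rewrite -unitmx_tr -row_free_unit; apply: inj_row_free => v vA.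
by apply: trmx_inj; rewrite trmx0; apply: Ainj; rewrite -[A]trmxK -trmx_mul vA trmx0.
Qed.

(** The target size is a variable so that [e] can be eliminated; this strips the size cast from the
    Jacobian before its blocks are multiplied. *)
Lemma castmx_row_mul_eq0 (R : pzRingType) (m m' n p : nat) (e : m = m')
    (A : 'M[R]_(m, n)) (B : 'M[R]_(n, p)) :
  castmx (e, erefl) A *m B = 0 -> A *m B = 0.
Proof. by case: m' / e; rewrite castmx_id. Qed.

Lemma mul_mx_rows (R : pzSemiRingType) (m n p : nat) (T : {set 'I_m})
    (A : 'M[R]_(m, n)) (B : 'M[R]_(n, p)) :
  mx_rows T A *m B = mx_rows T (A *m B).
Proof. exact: mul_rowsub_mx. Qed.

(** In the sum over the inner index, the terms outside [T] meet zero rows of [B]. *)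
Lemma mulmx_supported (R : pzSemiRingType) (m n p : nat) (T : {set 'I_n})
    (A : 'M[R]_(m, n)) (B : 'M[R]_(n, p)) :
  mx_rows (~: T) B = 0 -> A *m B = mx_cols T A *m mx_rows T B.
Proof.
move=> /matrixP BTC; apply/matrixP => i k; rewrite !mxE.
rewrite (bigID (mem T)) /= addrC big1 ?add0r => [|j jT].
  by rewrite big_enum_val; apply: eq_bigr => j _; rewrite !mxE.
have jTC : j \in ~: T by rewrite inE.
(* [enum_rank_in jTC j] is the position of row [j] among the rows indexed by [~: T]. *)
by have := BTC (enum_rank_in jTC j) k; rewrite !mxE enum_rankK_in// => ->; rewrite mulr0.
Qed.

Lemma mx_rows_eq0 (R : pzSemiRingType) (n p : nat) (T : {set 'I_n})
    (B : 'M[R]_(n, p)) :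
  mx_rows T B = 0 -> mx_rows (~: T) B = 0 -> B = 0.
Proof.
by move=> BT BTC; rewrite -[B]mul1mx (mulmx_supported _ BTC) BT mulmx0.
Qed.

(* Pairing the first block with [d] kills the multiplier term, since
   [A_T d_T = 0]. *)
Lemma sparse_KKT_inj (R : realFieldType) (n m : nat) (T : {set 'I_n})
    (H : 'M[R]_n) (A : 'M[R]_(m, n)) (d : 'cV[R]_n) (y : 'cV[R]_m) :
  \rank (mx_cols T A) = m ->
  (forall d : 'cV[R]_#|T|, d != 0 -> mx_cols T A *m d = 0 ->
     0 < (d^T *m mx_block T T H *m d) 0 0) ->
  mx_rows T H *m d - (mx_cols T A)^T *m y = 0 ->
  mx_rows (~: T) d = 0 -> A *m d = 0 -> d = 0 /\ y = 0.
Proof.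
move=> rA posH Hdy dTC; rewrite (mulmx_supported _ dTC) => Ad.
have HT : mx_cols T (mx_rows T H) = mx_block T T H.
  by apply/matrixP => i j; rewrite !mxE.
move: Hdy; rewrite (mulmx_supported _ dTC) HT => Hdy.
have dT : mx_rows T d = 0.
  apply/eqP/negPn/negP => /posH /(_ Ad).
  rewrite -mulmxA (subr0_eq Hdy) mulmxA -trmx_mul Ad trmx0 mul0mx mxE.
  by rewrite ltxx.
split; first exact: mx_rows_eq0 dT dTC.
(* With [d_T = 0] only [A_T^T y = 0] remains, and the full row rank of [A_T] forces [y = 0]. *)
move: Hdy; rewrite dT mulmx0 sub0r => /eqP; rewrite oppr_eq0 => /eqP Ay.
apply: trmx_inj; rewrite trmx0.
have /row_free_inj inj : row_free (mx_cols T A) by rewrite /row_free rA.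
by apply: inj; rewrite mul0mx -[LHS]trmxK trmx_mul trmxK Ay trmx0.
Qed.

Theorem theorem3p4 (R : realType) (n m s : nat)
    (f : 'rV[R]_n -> R) (h : 'rV[R]_n -> 'rV[R]_m) (beta : R)
    (xs : 'rV[R]_n) (ys : 'rV[R]_m) :
  (0 < m)%N -> (0 < s)%N -> (s < n)%N ->
  twice_continuously_differentiable f ->
  (forall i : 'I_m, twice_continuously_differentiable (fun x => h x 0 i)) ->
  0 < beta ->
  strong_stationary f h s beta xs ys ->
  (forall T : {set 'I_n}, T \in index_sets_at s xs ->
     \rank (mx_cols T (Jac h xs)) = m /\
     (forall d : 'cV[R]_#|T|, d != 0 -> mx_cols T (Jac h xs) *m d = 0 ->
        0 < (d^T *m mx_block T T (hess_L f h xs ys) *m d) 0 0)) ->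
  forall T : {set 'I_n}, T \in TT f h s beta xs ys ->
    Jac_stationarity_map f h T xs ys \in unitmx.
Proof.
move=> _ _ _ f2 h2 _ stat hyp T TTT.
have [rA posH] := hyp T (TT_index_sets_at stat TTT).
rewrite Jac_stationarity_mapE//; apply: unitmx_mulmx_inj => v.
move/castmx_row_mul_eq0; rewrite -[v]vsubmxK.
set d := usubmx v; set y := dsubmx v.
rewrite !mul_col_mx !mul_row_col !mul0mx !addr0 mulNmx
  [mx_rows (~: T) _ *m _]mul_mx_rows mul1mx.
(* Splitting the zero column along the same row blocks yields, up to the sign of the third, the
   three equations required by [sparse_KKT_inj]. *)
rewrite -[RHS]vsubmxK => /eq_col_mx[].
rewrite -[dsubmx 0]vsubmxK !linear0 => Hdy /eq_col_mx[dTC].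
rewrite mulNmx => /eqP; rewrite oppr_eq0 => /eqP Ad.
have [-> ->] : d = 0 /\ y = 0.
  by apply: sparse_KKT_inj rA posH _ dTC Ad.
by rewrite col_mx0.
Qed.
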